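(* Let $C$ be the absolute constant in the known inequality between linear sampling widths and Kolmogorov widths recalled in the context, i.e. a constant such that $g_{2n}^{\mathrm{lin}}(\mathcal F)_\infty\le C\sqrt n\,d_n(\mathcal F)_{B(D)}$ for every $n\in\mathbb N$, every set $D$, and every $\mathcal F$ that is the unit ball of a normed space of functions on $D$ embedding continuously into $B(D)$. Let $\mathcal A$ be a compact subset of a normed space $X$ and define $$\tau_m(\mathcal A)_X:=\inf_{a_1,\dots,a_m\in\mathcal A}\ \sup_{a\in\mathcal A}\ \mathrm{dist}_X\bigl(a,\mathrm{span}\{a_1,\dots,a_m\}\bigr).$$ Then $$\tau_{2m}(\mathcal A)_X\le C\sqrt m\;d_m(\mathcal A)_X\qquad\text{for all } m\in\mathbb N .$$
   Context: All vector spaces are over $\mathbb C$. For a set $D$, $B(D)$ is the space of bounded functions $D\to\mathbb C$ with norm $\|f\|_\infty=\sup_{x\in D}|f(x)|$. Kolmogorov widths: for a subset $\mathcal F$ of a normed space $X$ (no structure on $\mathcal F$ required), $$d_n(\mathcal F)_X:=\inf_{V\subset X,\ \dim V\le n}\ \sup_{a\in\mathcal F}\ \mathrm{dist}_X(a,V),$$ the infimum over linear subspaces $V$ of $X$ (not necessarily spanned by elements of $\mathcal F$). Linear sampling widths: for a class $\mathcal F$ of bounded functions on $D$ and $m\ge1$, $$g_m^{\mathrm{lin}}(\mathcal F)_\infty:=\inf_{x_1,\dots,x_m\in D,\ \varphi}\ \sup_{f\in\mathcal F}\|f-\varphi(f(x_1),\dots,f(x_m))\|_\infty,$$ the infimum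 over all points and all linear maps $\varphi\colon\mathbb C^m\to B(D)$. Known inequality (Krieg, Pozharska, M. Ullrich, T. Ullrich), which fixes the constant $C$ of the claim and may be taken as given: there is an absolute constant $C$ such that for every set $D$, every normed space $F$ of functions on $D$ that embeds continuously into $B(D)$, with unit ball $\mathcal F$, and every $n\in\mathbb N$, $g_{2n}^{\mathrm{lin}}(\mathcal F)_\infty\le C\sqrt n\,d_n(\mathcal F)_{B(D)}$. *)

(* Defs.v *)
From HB Require Import structures.
From mathcomp Require Import all_boot all_order all_algebra.
From mathcomp Require Import all_classical all_reals all_analysis.
From mathcomp Require Import complex.

Set Implicit Arguments.
Unset Strict Implicit.
Unset Printing Implicit Defensive.

Import Order.TTheory GRing.Theory Num.Theory.

Local Open Scope classical_set_scope.
Local Open Scope complex_scope.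
Local Open Scope ring_scope.

(* The norm of a normed space over R[i] takes values in R[i] (which are
   nonnegative reals); rnorm is the same norm with values in R. *)
Definition rnorm (R : realType) (V : normedZmodType R[i]) (x : V) : R :=
  complex.Re `|x|.

Section rnorm_theory.
Variable R : realType.

Lemma rnormE (V : normedZmodType R[i]) (x : V) : (rnorm x)%:C = `|x|.
Proof. by rewrite /rnorm RRe_real// ger0_real. Qed.

Lemma rnorm_ge0 (V : normedZmodType R[i]) (x : V) : 0 <= rnorm x.
Proof. by rewrite -lecR rnormE normr_ge0. Qed.

Lemma rnorm0 (V : normedZmodType R[i]) : rnorm (0 : V) = 0.
Proof. by rewrite /rnorm normr0. Qed.

Lemma rnorm_eq0 (V : normedZmodType R[i]) (x : V) : rnorm x = 0 -> x = 0.
Proof. by move=> x0; apply/normr0_eq0; rewrite -rnormE x0. Qed.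

Lemma rnormD (V : normedZmodType R[i]) (x y : V) :
  rnorm (x + y) <= rnorm x + rnorm y.
Proof. by rewrite -lecR rmorphD/= !rnormE ler_normD. Qed.

Lemma rnormM (x y : R[i]) : rnorm (x * y) = rnorm x * rnorm y.
Proof.
by apply: (@complexI R); rewrite rmorphM/= !rnormE normrM.
Qed.

End rnorm_theory.

Section bounded_functions.
Variables (R : realType) (D : Type).

Definition is_bounded (f : D -> R[i]) : bool :=
  `[< has_ubound (range (fun x => rnorm (f x))) >].

Lemma is_boundedP (f : D -> R[i]) :
  reflect (exists M, forall x, rnorm (f x) <= M) (is_bounded f).
Proof.
apply: (iffP (asboolP _)) => -[M fM]; exists M.
  by move=> x; apply: fM; exists x.
by move=> _ [x _ <-].
Qed.

Lemma is_bounded_submod_closed : submod_closed is_bounded.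
Proof.
split.
  by apply/is_boundedP; exists 0 => x; rewrite rnorm0.
move=> a f g /is_boundedP[M fM] /is_boundedP[N gN].
apply/is_boundedP; exists (rnorm a * M + N) => x.
apply: (le_trans (rnormD _ _)); apply: lerD => //.
by rewrite rnormM ler_wpM2l ?rnorm_ge0.
Qed.

HB.instance Definition _ :=
  GRing.isSubmodClosed.Build _ _ is_bounded is_bounded_submod_closed.

Record bfun := BFun { bfun_val :> D -> R[i]; _ : is_bounded bfun_val }.

HB.instance Definition _ := [isSub for bfun_val].
HB.instance Definition _ := [Choice of bfun by <:].
HB.instance Definition _ := [SubChoice_isSubLmodule of bfun by <:].

Definition supnorm (f : bfun) : R := sup (range (fun x => rnorm (f x))).

Lemma rnorm_le_supnorm (f : bfun) x : rnorm (f x) <= supnorm f.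
Proof.
by apply: ub_le_sup; [exact/asboolP/(valP f) | exists x].
Qed.

Lemma supnorm_le (f : bfun) M :
  0 <= M -> (forall x, rnorm (f x) <= M) -> supnorm f <= M.
Proof.
move=> M0 fM; rewrite /supnorm.
have [->|/set0P ne] := eqVneq (range (fun x => rnorm (f x))) set0.
  by rewrite sup0.
by apply: ge_sup => // _ [x _ <-].
Qed.

Lemma supnorm_ge0 (f : bfun) : 0 <= supnorm f.
Proof.
have [D0|/set0P[_ [x _ _]]] := eqVneq (range (fun x => rnorm (f x))) set0.
  by rewrite /supnorm D0 sup0.
exact: le_trans (rnorm_ge0 (f x)) (rnorm_le_supnorm f x).
Qed.

Let norm (f : bfun) : R[i] := (supnorm f)%:C.

Let normD f g : norm (f + g) <= norm f + norm g.
Proof.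
rewrite /norm -rmorphD/= lecR supnorm_le ?addr_ge0 ?supnorm_ge0// => x.
by rewrite (le_trans (rnormD _ _))// lerD ?rnorm_le_supnorm.
Qed.

Let supnormZ_le a f : supnorm (a *: f) <= rnorm a * supnorm f.
Proof.
rewrite supnorm_le ?mulr_ge0 ?rnorm_ge0 ?supnorm_ge0// => x.
by rewrite [X in rnorm X](_ : _ = a * f x)// rnormM ler_wpM2l ?rnorm_ge0
  ?rnorm_le_supnorm.
Qed.

Let normZ a f : norm (a *: f) = `|a| * norm f.
Proof.
rewrite /norm -rnormE -rmorphM/=; congr (_%:C).
apply/eqP; rewrite eq_le supnormZ_le/=.
have [->|a0] := eqVneq a 0; first by rewrite rnorm0 mul0r supnorm_ge0.
have ra0 : 0 < rnorm a.
  rewrite lt_neqAle rnorm_ge0 andbT eq_sym.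
  by apply: contra_neq a0; exact: rnorm_eq0.
have ri : rnorm a * rnorm a^-1 = 1 by rewrite -rnormM divff// /rnorm normr1.
rewrite -[leRHS]mul1r -ri -mulrA ler_pM2l//.
by rewrite -[in leLHS](scale1r f) -(mulVf a0) -scalerA supnormZ_le.
Qed.

Let norm0_eq0 f : norm f = 0 -> f = 0.
Proof.
move=> [f0]; apply/val_inj/funext => x /=.
apply: rnorm_eq0; apply/eqP; rewrite eq_le rnorm_ge0 andbT -f0.
exact: rnorm_le_supnorm.
Qed.

HB.instance Definition _ :=
  Lmodule_isNormed.Build R[i] bfun normD normZ norm0_eq0.

Lemma rnorm_bfunE (f : bfun) : rnorm f = sup (range (fun x => rnorm (f x))).
Proof. by []. Qed.

End bounded_functions.

Arguments bfun : clear implicits.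

Section widths.
Variables (R : realType) (X : normedModType R[i]).
Local Open Scope ereal_scope.

Definition dist (x : X) (V : set X) : \bar R :=
  ereal_inf [set (rnorm (x - v))%:E | v in V].

Definition deviation (A V : set X) : \bar R :=
  ereal_sup [set dist a V | a in A].

Definition lin_span (k : nat) (b : 'I_k -> X) : set X :=
  range (fun c : 'I_k -> R[i] => \sum_(i < k) c i *: b i)%R.

Definition lin_indep (k : nat) (b : 'I_k -> X) : Prop :=
  forall c : 'I_k -> R[i],
    (\sum_(i < k) c i *: b i = 0)%R -> forall i, c i = 0%R.

(* dim V <= n means that V has a basis of at most n vectors; that V is a linear
   subspace then follows from V being a span. *)
Definition subspace_dim_le (n : nat) (V : set X) : Prop :=
  exists k (b : 'I_k -> X), [/\ (k <= n)%N, lin_indep b & V = lin_span b].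

Definition kolmogorov_width (n : nat) (A : set X) : \bar R :=
  ereal_inf [set deviation A V | V in subspace_dim_le n].

Definition tau (m : nat) (A : set X) : \bar R :=
  ereal_inf [set deviation A (lin_span a) | a in
    [set a : 'I_m -> X | forall i, A (a i)]].

End widths.

Definition lin_sampling_width (R : realType) (D : Type) (m : nat)
    (F : set (bfun R D)) : \bar R :=
  ereal_inf [set ereal_sup
      [set (rnorm (f - p.2 (\row_i f (p.1 i))))%:E | f in F]
    | p in [set: ('I_m -> D) * {linear 'rV[R[i]]_m -> bfun R D}]].

(* A normed space of functions on D that embeds continuously into B(D) is given
   as a normed space E with an injective continuous linear map iota, sending an
   element of E to the function that it is. D must be nonempty: on the empty
   set there are no sampling points, so the left-hand side would be +oo. *)
Definition sampling_constant (R : realType) (C : R) : Prop :=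
  forall (D : Type) (E : normedModType R[i]) (iota : {linear E -> bfun R D}),
    [set: D] !=set0 -> injective iota -> continuous iota ->
  forall n : nat, (0 < n)%N ->
    let F := [set iota f | f in [set f : E | rnorm f <= 1]] in
    (lin_sampling_width (2 * n) F
      <= (C * Num.sqrt n%:R)%:E * kolmogorov_width n F)%E.

(* Main.v *)
(* By duality, the widths of A in X are those of a class of functions on A.
   Let F be the set of restrictions to A of the functionals in the unit ball of
   the dual of X.  If v(a) is an approximation of a in an m-dimensional space V,
   the functions a |-> f(v(a)) approximate F and span a space of dimension at
   most m, so d_m(F) <= d_m(A).  Conversely, a linear sampling algorithm
   f |-> \sum_i f(a_i) phi_i for F has at the point a the error
   f(a - \sum_i phi_i(a) a_i), whose supremum over f is, by Hahn-Banach, the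
   norm of a - \sum_i phi_i(a) a_i; hence tau_n(A) <= g_n(F). *)
Require Import Defs.
From HB Require Import structures.
From mathcomp Require Import all_boot all_order all_algebra.
From mathcomp Require Import all_classical all_reals all_analysis.
From mathcomp Require Import complex.
From mathcomp Require Import ring lra.

Set Implicit Arguments.
Unset Strict Implicit.
Unset Printing Implicit Defensive.

Import Order.TTheory GRing.Theory Num.Theory.

Local Open Scope classical_set_scope.
Local Open Scope complex_scope.
Local Open Scope ring_scope.


(** * Real Hahn-Banach theorem for sublinear functionals *)

Section sublinear.
Variables (R : realType) (V : lmodType R[i]).
Implicit Types (p : V -> R) (x y : V).

(** Positive homogeneity is asked only as an inequality, which passes easily to infima; applying it
    to [t^-1] as well gives equality. *)
Definition sublinear p :=
  (forall x y, p (x + y) <= p x + p y) /\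
  (forall (t : R) x, 0 < t -> p (t%:C *: x) <= t * p x).

Lemma sublinear0 p : sublinear p -> p 0 = 0.
Proof.
move=> [_ pZ]; have := pZ 2 0 (ltr0Sn _ _); have := pZ 2^-1 0.
by rewrite !scaler0 invr_gt0 ltr0Sn => /(_ isT); lra.
Qed.

Lemma sublinearZ p (t : R) x : sublinear p -> 0 <= t ->
  p (t%:C *: x) = t * p x.
Proof.
move=> ps; rewrite le_eqVlt => /predU1P[<-|t0].
  by rewrite scale0r mul0r sublinear0.
apply/eqP; rewrite eq_le ps.2//= -ler_pdivlMl//.
have := ps.2 t^-1 (t%:C *: x); rewrite invr_gt0 => /(_ t0).
by rewrite scalerA -rmorphM/= mulVf ?gt_eqF// scale1r.
Qed.

Lemma sublinear_geN p x : sublinear p -> - p (- x) <= p x.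
Proof.
by move=> ps; have := ps.1 x (- x); rewrite subrr sublinear0//; lra.
Qed.

Lemma le_inf_add (A B : set R) (z : R) : A !=set0 -> B !=set0 ->
  (forall a b, A a -> B b -> z <= a + b) -> z <= inf A + inf B.
Proof.
move=> A0 B0 zAB; rewrite -lerBlDr; apply: lb_le_inf => // a Aa.
by rewrite lerBlDr -lerBlDl; apply: lb_le_inf => // b Bb; rewrite lerBlDl zAB.
Qed.

(** Serves both [tilt] and the infimum of a chain in Zorn's lemma. For sums, [k] is the sum of the
    two parameters in the first use and the smaller of the two functionals in the second. *)
Lemma inf_sublinear (I : Type) (D : set I) (g : I -> V -> R) : D !=set0 ->
    (forall x, has_lbound [set g i x | i in D]) ->
    (forall i j x y, D i -> D j ->
      exists2 k, D k & g k (x + y) <= g i x + g j y) ->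
    (forall i (t : R) x, D i -> 0 < t ->
      exists2 k, D k & g k (t%:C *: x) <= t * g i x) ->
  sublinear (fun x => inf [set g i x | i in D]).
Proof.
move=> [i0 Di0] glb gD gZ.
have ne x : [set g i x | i in D] !=set0 by exists (g i0 x), i0.
split=> [x y|t x t0].
  apply: le_inf_add => // _ _ [i Di <-] [j Dj <-].
  have [k Dk] := gD i j x y Di Dj; apply: le_trans.
  by apply: ge_inf => //; exists k.
rewrite -ler_pdivrMl//; apply: lb_le_inf => // _ [i Di <-].
rewrite ler_pdivrMl//; have [k Dk] := gZ i t x Di t0; apply: le_trans.
by apply: ge_inf => //; exists k.
Qed.

(* The largest sublinear functional below p that is at most - p y at - y. *)
Definition tilt p y x :=
  inf [set p (x + t%:C *: y) - t * p y | t in [set t | 0 <= t]].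

Lemma tilt_has_lbound p y x : sublinear p ->
  has_lbound [set p (x + t%:C *: y) - t * p y | t in [set t | 0 <= t]].
Proof.
move=> ps; exists (- p (- x)) => _ [t /= t0 <-].
have := ps.1 (x + t%:C *: y) (- x).
by rewrite addrAC subrr add0r sublinearZ//; lra.
Qed.

Lemma tilt_sublinear p y : sublinear p -> sublinear (tilt p y).
Proof.
move=> ps; apply: inf_sublinear => [|x|s t x z s0 t0|s t x s0 t0].
- by exists 0 => /=.
- exact: tilt_has_lbound.
- exists (s + t); first exact: addr_ge0.
  rewrite rmorphD/= scalerDl addrACA.
  by have := ps.1 (x + s%:C *: y) (z + t%:C *: y); lra.
- exists (t * s); first exact: mulr_ge0 (ltW t0) _.
  rewrite rmorphM/= -scalerA -scalerDr sublinearZ ?(ltW t0)//.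
  by rewrite -mulrA -mulrBr.
Qed.

Lemma tilt_le p y x t : sublinear p -> 0 <= t ->
  tilt p y x <= p (x + t%:C *: y) - t * p y.
Proof. by move=> ps t0; apply: ge_inf; [exact: tilt_has_lbound|exists t]. Qed.

Lemma sublinear_minimal p : sublinear p -> exists q,
  [/\ sublinear q, forall x, q x <= p x &
      forall r, sublinear r -> (forall x, r x <= q x) -> r = q].
Proof.
move=> ps; pose P q := sublinear q /\ forall x, q x <= p x.
pose T := {q | P q}.
pose le (q r : T) := `[< forall x, sval r x <= sval q x >].
have [|||A Atot|[q [qs qp]] qmin] := @Zorn T le.
- by move=> q; apply/asboolP.
- move=> q r s /asboolP qr /asboolP rs; apply/asboolP => x.
  exact: le_trans (rs x) (qr x).
- move=> [q qP] [r rP] /asboolP/= qr /asboolP/= rq.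
  apply: eq_exist; apply/funext => x.
  by apply/eqP; rewrite eq_le qr rq.
- have [->|/set0P A0] := eqVneq A set0.
    by exists (exist P p (conj ps (fun x => lexx _))).
  have Alb x : has_lbound [set sval q x | q in A].
    exists (- p (- x)) => _ [q Aq <-]; have [qs qp] := svalP q.
    by apply: le_trans (sublinear_geN _ qs); rewrite lerN2.
  have infs : sublinear (fun x => inf [set sval q x | q in A]).
    apply: inf_sublinear => // [q r x y Aq Ar|q t x Aq t0].
      have [qs _] := svalP q; have [rs _] := svalP r.
      have [/asboolP qr|/asboolP rq] := Atot q r Aq Ar.
        by exists r => //; apply: le_trans (rs.1 _ _) _; rewrite lerD2r.
      by exists q => //; apply: le_trans (qs.1 _ _) _; rewrite lerD2l.
    by exists q => //; have [qs _] := svalP q; exact: qs.2.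
  have infp x : inf [set sval q x | q in A] <= p x.
    have [q Aq] := A0; have [_ qp] := svalP q.
    by apply: le_trans (qp x); apply: ge_inf => //; exists q.
  exists (exist P _ (conj infs infp)) => q Aq; apply/asboolP => x /=.
  by apply: ge_inf => //; exists q.
- exists q; split => // r rs rq.
  have rp x : r x <= p x by exact: le_trans (rq x) (qp x).
  have /(_ _)/(congr1 sval) := qmin (exist P r (conj rs rp)).
  by apply; apply/asboolP.
Qed.

(** A minimal sublinear [u] below [tilt p y] is additive: [tilt u z] is sublinear and below [u],
    hence equal to [u], and its term at t = 1 gives [u x <= u (x + z) - u z]. *)
Lemma hahn_banach p y : sublinear p -> exists u : V -> R,
  [/\ forall x z, u (x + z) = u x + u z,
      forall (t : R) x, u (t%:C *: x) = t * u x,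
      forall x, u x <= p x & u y = p y].
Proof.
move=> ps; have [u [us up umin]] := sublinear_minimal (tilt_sublinear y ps).
have uD x z : u (x + z) = u x + u z.
  apply/eqP; rewrite eq_le us.1/=.
  have -> : u x = tilt u z x.
    rewrite [tilt u z](umin _ (tilt_sublinear z us))// => w.
    by have := @tilt_le u z w 0 us (lexx 0); rewrite scale0r addr0 mul0r subr0.
  by have := @tilt_le u z x 1 us ler01; rewrite scale1r mul1r lerBrDr.
have uN x : u (- x) = - u x.
  by apply/eqP; rewrite -addr_eq0 -uD addNr sublinear0.
have up' x : u x <= p x.
  apply: le_trans (up x) _.
  by have := @tilt_le p y x 0 ps (lexx 0); rewrite scale0r addr0 mul0r subr0.
exists u; split => // [t x|].
  have [t0|t0] := leP 0 t; first exact: sublinearZ.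
  rewrite -[t in LHS]opprK rmorphN/= scaleNr uN sublinearZ ?oppr_ge0 ?ltW//.
  by rewrite mulNr opprK.
apply/eqP; rewrite eq_le up'/=.
(* The term t = 1 of [tilt p y (- y)] is [p 0 - p y], so [- u y <= - p y]. *)
have := up (- y); have := @tilt_le p y (- y) 1 ps ler01.
rewrite scale1r mul1r addNr sublinear0// uN; lra.
Qed.

End sublinear.

(** * Complex norming functionals *)

Section functionals.
Variables (R : realType) (X : normedModType R[i]).
Implicit Types (x : X) (f : X -> R[i]).

Lemma rnormZ (c : R[i]) x : rnorm (c *: x) = rnorm c * rnorm x.
Proof. by apply: (@complexI R); rewrite rmorphM/= !rnormE normrZ. Qed.

Lemma rnormC (t : R) : rnorm t%:C = `|t|.
Proof. by rewrite /rnorm normc_def/= expr0n addr0 sqrtr_sqr. Qed.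

Lemma rnorm_sublinear : sublinear (@rnorm R X).
Proof.
split=> [x y|t x t0]; first exact: rnormD.
by rewrite rnormZ rnormC gtr0_norm.
Qed.

Definition bounded_functional (M : R) f :=
  scalar f /\ forall x, rnorm (f x) <= M * rnorm x.

Lemma complex_i_scale (a b : R) x :
  (a +i* b) *: x = a%:C *: x + b%:C *: ('i%C *: x).
Proof.
by rewrite scalerA -scalerDl [a +i* b]complexE/= [b%:C * _]mulrC.
Qed.

Lemma norming_functional x :
  exists2 f, bounded_functional 1 f & rnorm x <= rnorm (f x).
Proof.
have [u [uD uZ ule ux]] := hahn_banach x rnorm_sublinear.
(* The complex-linear functional with real part [u]. *)
pose f z : R[i] := u z +i* - u ('i%C *: z).
have fs : scalar f.
  move=> [a b] y z; rewrite /f.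
  have iab : 'i%C * (a +i* b) = - b +i* a.
    by apply/eqP; rewrite eq_complex/=; apply/andP; split; apply/eqP; ring.
  rewrite scalerDr scalerA iab.
  rewrite (complex_i_scale a b) (complex_i_scale (- b) a) !uD !uZ.
  by apply/eqP; rewrite eq_complex/=; apply/andP; split; apply/eqP; ring.
exists f; last first.
  rewrite -ux /f /rnorm normc_def/=.
  rewrite (le_trans (ler_norm _))// -sqrtr_sqr ler_wsqrtr//.
  by rewrite lerDl sqr_ge0.
split=> // y; rewrite mul1r.
have [->|fy0] := eqVneq (f y) 0; first by rewrite rnorm0 rnorm_ge0.
(* Rotating [y] by a unimodular [c] makes the value of [f] real and nonnegative, so it equals
   [u (c *: y)], which the norm bounds. *)
pose c : R[i] := `|f y| / f y.
have c1 : rnorm c = 1.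
  by rewrite /rnorm normrM normrV ?unitfE// normr_id divff ?normr_eq0.
have fc : f (c *: y) = `|f y|.
  have f0 : f 0 = 0 by have := fs (-1) 0 0; rewrite scaler0 addr0 mulN1r addNr.
  by have := fs c y 0; rewrite !addr0 f0 addr0 divfK.
have -> : rnorm (f y) = u (c *: y) by rewrite /rnorm -fc.
by rewrite (le_trans (ule _))// rnormZ c1 mul1r.
Qed.

End functionals.

(** * Linear combinations of bounded functionals *)

Section bounded_functional_theory.
Variables (R : realType) (X : normedModType R[i]).
Implicit Types (f g : X -> R[i]) (M N : R).

Lemma bounded_functional0 : @bounded_functional R X 0 (fun=> 0).
Proof.
split=> [a x y|x]; first by rewrite mulr0 addr0.
by rewrite rnorm0 mul0r.
Qed.

Lemma bounded_functionalP M N (a : R[i]) f g :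
  bounded_functional M f -> bounded_functional N g ->
  bounded_functional (rnorm a * M + N) (fun x => a * f x + g x).
Proof.
move=> [fs fM] [gs gN]; split=> [b x y|x].
  by rewrite /= fs gs; ring.
rewrite (le_trans (rnormD _ _))// mulrDl lerD// rnormM -mulrA.
by rewrite ler_wpM2l ?rnorm_ge0.
Qed.

Lemma le_bounded_functional M N f :
  M <= N -> bounded_functional M f -> bounded_functional N f.
Proof.
move=> MN [fs fM]; split=> // x; apply: le_trans (fM x) _.
by rewrite ler_wpM2r ?rnorm_ge0.
Qed.

Lemma bounded_functional_sum M f (I : Type) (r : seq I) (c : I -> R[i])
    (x : I -> X) : bounded_functional M f ->
  f (\sum_(i <- r) c i *: x i) = \sum_(i <- r) c i * f (x i).
Proof.
move=> [fs _]; elim: r => [|i r IH].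
  by rewrite !big_nil; have := fs (-1) 0 0; rewrite scaler0 addr0 mulN1r addNr.
by rewrite !big_cons fs IH.
Qed.

Lemma bounded_functionalB M f x y : bounded_functional M f ->
  f (x - y) = f x - f y.
Proof.
by move=> [fs _]; rewrite addrC -scaleN1r fs mulN1r addrC.
Qed.

End bounded_functional_theory.

(** * The dual of [X] restricted along [j], as a normed space of functions *)

Section restricted_dual.
Variables (R : realType) (X : normedModType R[i]) (T : Type) (j : T -> X).
Implicit Types (f : X -> R[i]) (h : T -> R[i]) (M : R).

Definition extends M f h := bounded_functional M f /\ h = f \o j.

Definition extendable h : bool := `[< exists M f, extends M f h >].

Lemma extendable_submod_closed : submod_closed extendable.
Proof.
split.
  apply/asboolP; exists 0, (fun=> 0); split=> //.
  exact: bounded_functional0.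
move=> a f g /asboolP[M [f' [f'M ->]]] /asboolP[N [g' [g'N ->]]].
apply/asboolP; exists (rnorm a * M + N), (fun x => a * f' x + g' x).
by split=> //; exact: bounded_functionalP.
Qed.

HB.instance Definition _ :=
  GRing.isSubmodClosed.Build _ _ extendable extendable_submod_closed.

(* The functions on T that are of the form f \o j with f in the dual of X, with
   the quotient norm; injectivity of the embedding into B(T) is then free even
   if the range of j does not span a dense subspace. *)
Record rdual := RDual { rdual_val :> T -> R[i]; _ : extendable rdual_val }.

HB.instance Definition _ := [isSub for rdual_val].
HB.instance Definition _ := [Choice of rdual by <:].
HB.instance Definition _ := [SubChoice_isSubLmodule of rdual by <:].

Implicit Types g : rdual.

(** If [X] is the zero space, every real [M] is a bound for the zero functional; [0 <= M] keeps the
    infimum meaningful there. *)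
Definition rdual_bounds g : set R :=
  [set M | 0 <= M /\ exists f, extends M f g].

Definition rdual_norm g : R := inf (rdual_bounds g).

Let rdual_bounds_neq0 g : rdual_bounds g !=set0.
Proof.
have /asboolP[M [f [fM gf]]] := valP g; exists `|M|; split=> //; exists f.
by split=> //; apply: le_bounded_functional fM; exact: ler_norm.
Qed.

Let rdual_bounds_lb g : has_lbound (rdual_bounds g).
Proof. by exists 0 => M []. Qed.

Lemma rdual_norm_le M f g : 0 <= M -> extends M f g -> rdual_norm g <= M.
Proof. by move=> M0 fg; apply: ge_inf => //; split=> //; exists f. Qed.

(** The strict inequality yields an extension without showing that the infimum is attained. *)
Lemma rdual_norm_lt M g : rdual_norm g < M -> exists f, extends M f g.
Proof.
move=> /inf_lt[//|N [N0 [f [fN gf]]]] NM; exists f; split=> //.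
exact: le_bounded_functional (ltW NM) fN.
Qed.

Lemma rdual_norm_ge0 g : 0 <= rdual_norm g.
Proof. by apply: lb_le_inf => // M []. Qed.

Lemma rdual_le_norm g t : rnorm (g t) <= rdual_norm g * rnorm (j t).
Proof.
(* One cannot divide by [rnorm (j t)] when it vanishes; any extension is then 0 at [j t]. *)
have [jt0|jt0] := eqVneq (rnorm (j t)) 0.
  have [M [f [[_ fM] ->]]] := asboolP _ (valP g).
  by rewrite jt0 mulr0 -(mulr0 M) -jt0 fM.
have jt_gt0 : 0 < rnorm (j t) by rewrite lt_neqAle eq_sym jt0 rnorm_ge0.
rewrite -ler_pdivrMr//; apply: lb_le_inf => // M [_ [f [[_ fM] gf]]].
by rewrite ler_pdivrMr// gf fM.
Qed.

Lemma rdual_normD g g' : rdual_norm (g + g') <= rdual_norm g + rdual_norm g'.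
Proof.
apply: le_inf_add => // M N [M0 [f [fM gf]]] [N0 [f' [f'N g'f']]].
(* The sum is put in the form [1 * f + f'] of [bounded_functionalP], with [M] as [rnorm 1 * M]. *)
rewrite -[M]mul1r -(normr1 R) -rnormC.
apply: (@rdual_norm_le _ (fun x => 1%:C * f x + f' x)).
  by rewrite addr_ge0// mulr_ge0// rnorm_ge0.
split; first exact: bounded_functionalP.
apply/funext => t; rewrite /= mul1r.
by rewrite -[f (j t)]/((f \o j) t) -gf -[f' (j t)]/((f' \o j) t) -g'f'.
Qed.

Lemma rdual_normZ_le a g : rdual_norm (a *: g) <= rnorm a * rdual_norm g.
Proof.
have [->|a0] := eqVneq a 0.
  rewrite rnorm0 mul0r scale0r; apply: (@rdual_norm_le _ (fun=> 0)) => //.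
  by split=> //; exact: bounded_functional0.
have ra0 : 0 < rnorm a.
  rewrite lt_neqAle rnorm_ge0 andbT eq_sym.
  by apply: contra_neq a0; exact: rnorm_eq0.
rewrite -ler_pdivrMl//; apply: lb_le_inf => // M [M0 [f [fM gf]]].
rewrite ler_pdivrMl// -[_ * M]addr0.
apply: (@rdual_norm_le _ (fun x => a * f x + 0)).
  by rewrite addr0 mulr_ge0// rnorm_ge0.
split; first exact: bounded_functionalP fM (bounded_functional0 X).
by apply/funext => t; rewrite /= addr0 -[f (j t)]/((f \o j) t) -gf.
Qed.

Let norm g : R[i] := (rdual_norm g)%:C.

Let normD g g' : norm (g + g') <= norm g + norm g'.
Proof. by rewrite /norm -rmorphD/= lecR rdual_normD. Qed.

Let normZ a g : norm (a *: g) = `|a| * norm g.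
Proof.
rewrite /norm -rnormE -rmorphM/=; congr (_%:C).
apply/eqP; rewrite eq_le rdual_normZ_le/=.
have [->|a0] := eqVneq a 0; first by rewrite rnorm0 mul0r rdual_norm_ge0.
have aV : rnorm a * rnorm a^-1 = 1 by rewrite -rnormM mulfV// /rnorm normr1.
rewrite -[leRHS]mul1r -aV -mulrA.
by rewrite ler_wpM2l ?rnorm_ge0// -[in leLHS](scale1r g) -(mulVf a0) -scalerA
  rdual_normZ_le.
Qed.

Let norm0_eq0 g : norm g = 0 -> g = 0.
Proof.
move=> [g0]; apply/val_inj/funext => t /=.
by apply: rnorm_eq0; apply/eqP; rewrite eq_le rnorm_ge0 andbT
  (le_trans (rdual_le_norm g t))// g0 mul0r.
Qed.

HB.instance Definition _ :=
  Lmodule_isNormed.Build R[i] rdual normD normZ norm0_eq0.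

Lemma rdual_embedding (K : R) : (forall t, rnorm (j t) <= K) ->
  exists iota : {linear rdual -> bfun R T},
    [/\ forall g t, iota g t = g t, injective iota & continuous iota].
Proof.
move=> jK.
have bnd g : is_bounded g.
  apply/is_boundedP; exists (rdual_norm g * K) => t.
  by rewrite (le_trans (rdual_le_norm g t))// ler_wpM2l ?rdual_norm_ge0.
pose i g := BFun (bnd g).
have il : linear i by move=> a g g'; apply: val_inj.
pose iH := GRing.isLinear.Build _ _ _ _ i il.
pose iota : {linear rdual -> bfun R T} := HB.pack i iH.
exists iota; split=> // [g g' gg'|].
  by apply: val_inj; exact: (congr1 val gg').
apply/bounded_linear_continuous/bounded_funP => r.
(* [K] may be negative when [T] is empty, hence its absolute value. The radius [r] is complex, but
   lying above a norm makes it real. *)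
exists (r * `|K|%:C) => g gr.
rewrite -(rnormE (iota g)) -(RRe_real (ger0_real (le_trans (normr_ge0 g) gr))).
rewrite -rmorphM/= lecR.
have gr' : rdual_norm g <= complex.Re r.
  by move: gr; rewrite -rnormE lecE => /andP[_].
apply: (@supnorm_le _ _ (iota g)) => [|t].
  by rewrite mulr_ge0// (le_trans _ gr')// rdual_norm_ge0.
rewrite (le_trans (rdual_le_norm g t))// ler_pM ?rdual_norm_ge0 ?rnorm_ge0//.
exact: le_trans (jK t) (ler_norm _).
Qed.

End restricted_dual.

(** * Dimension of a family that factors through a finite-dimensional space *)

Section finite_rank.
Variables (R : realType) (Y : normedModType R[i]).

(** The hypothesis says that [y] factors linearly through [x]. No factor map is built: a maximal
    independent family of values of [y] has at most [k] members and spans the rest. *)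
Lemma finite_rank_basis (T : Type) (k : nat) (x : T -> 'rV[R[i]]_k)
    (y : T -> Y) :
    (forall n (t : 'I_n -> T) (c : 'I_n -> R[i]),
      \sum_i c i *: x (t i) = 0 -> \sum_i c i *: y (t i) = 0) ->
  exists2 V, subspace_dim_le k V & forall s, V (y s).
Proof.
move=> xy.
pose P n := `[< exists t : 'I_n -> T, lin_indep (y \o t) >].
have P0 : P 0%N.
  apply/asboolP; exists (fun i : 'I_0 => False_rect _ (notF (ltn_ord i))).
  by move=> c _ [].
have Pk n : P n -> (n <= k)%N.
  move=> /asboolP[t tfree].
  (* A relation among the [x (t i)] passes to the independent [y (t i)], so these rows of length [k]
     are independent. *)
  have : row_free (\matrix_i x (t i)).
    apply: inj_row_free => v; rewrite mulmx_sum_row => v0.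
    apply/rowP => i; rewrite mxE; apply: (tfree (v 0)).
    by apply: xy; rewrite -[RHS]v0; apply: eq_bigr => l _; rewrite rowK.
  by move=> /eqP <-; exact: rank_leq_col.
have [n /asboolP[t tfree] nmax] := ex_maxnP (ex_intro P _ P0) Pk.
exists (lin_span (y \o t)).
  by exists n, (y \o t); split=> //; apply/Pk/asboolP; exists t.
move=> s.
pose t' (i : 'I_n.+1) := if unlift ord0 i is Some l then t l else s.
have t'E (c : 'I_n.+1 -> R[i]) : \sum_i c i *: y (t' i) =
    c ord0 *: y s + \sum_i c (lift ord0 i) *: y (t i).
  rewrite big_ord_recl {1}/t' unlift_none; congr (_ + _).
  by apply: eq_bigr => i _; rewrite /t' liftK.
have /existsNP[c /not_implyP[c0 /existsNP[i ci]]] : ~ lin_indep (y \o t').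
  move=> t'free; suff /nmax : P n.+1 by rewrite ltnn.
  by apply/asboolP; exists t'.
rewrite /= t'E in c0.
(* With coefficient 0 at [y s], the relation would be a nontrivial one among the independent
   [y \o t]; otherwise it is solved for [y s]. *)
have [c00|c00] := eqVneq (c ord0) 0.
  case: ci; rewrite c00 scale0r add0r in c0.
  by case: (unliftP ord0 i) => [l|] -> //; exact: (tfree (c \o lift ord0)).
exists (fun i => - ((c ord0)^-1 * c (lift ord0 i))) => //=.
apply: (scalerI c00); rewrite scaler_sumr.
move/eqP: c0; rewrite addr_eq0 => /eqP ->; rewrite -sumrN.
by apply: eq_bigr => l _; rewrite scalerA mulrN mulVKf// scaleNr.
Qed.

End finite_rank.

(** * The two width comparisons *)

Section duality.
Variables (R : realType) (X : normedModType R[i]) (T : Type) (j : T -> X).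
Variable iota : {linear rdual j -> bfun R T}.
Hypothesis iotaE : forall g t, iota g t = g t.

Let F := [set iota g | g in [set g : rdual j | rnorm g <= 1]].

Lemma bfun_sumE (I : Type) (r : seq I) (h : I -> bfun R T) t :
  (\sum_(i <- r) h i) t = \sum_(i <- r) h i t.
Proof. exact: (big_morph (fun h : bfun R T => h t)). Qed.

Lemma tau_le_sampling_width n :
  (tau n (range j) <= lin_sampling_width n F)%E.
Proof.
apply: le_ereal_inf_tmp => _ [[x phi] _ <-] /=.
apply: ge_ereal_inf; exists (deviation (range j) (lin_span (j \o x))).
  by exists (j \o x) => // i; exists (x i).
apply: ge_ereal_sup => _ [_ [t _ <-] <-].
(* The weight that the algorithm gives at [t] to the i-th sample; the same weights serve as
   coefficients of the [j (x i)] in approximating [j t]. *)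
pose c i := phi (delta_mx 0 i) t.
have phiE (h : 'I_n -> R[i]) : phi (\row_i h i) t = \sum_i h i * c i.
  rewrite [\row_i h i]row_sum_delta linear_sum bfun_sumE.
  by apply: eq_bigr => i _; rewrite linearZ mxE.
have [f fb fn] := norming_functional (j t - \sum_i c i *: j (x i)).
have fj : extendable j (f \o j) by apply/asboolP; exists 1, f.
pose g := RDual fj.
have g1 : rnorm g <= 1 by apply: (@rdual_norm_le _ _ _ _ 1 f g).
apply: ge_ereal_inf; exists (rnorm (j t - \sum_i c i *: j (x i)))%:E.
  by exists (\sum_i c i *: j (x i)) => //; exists c.
apply: le_ereal_sup_tmp.
exists (rnorm (iota g - phi (\row_i iota g (x i))))%:E.
  by exists (iota g) => //; exists g.
rewrite lee_fin; apply: le_trans fn _.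
apply: le_trans (rnorm_le_supnorm _ t).
rewrite [X in _ <= rnorm X](_ : _ = iota g t - phi (\row_i iota g (x i)) t)//.
rewrite phiE iotaE (bounded_functionalB _ _ fb).
rewrite (bounded_functional_sum _ _ _ fb).
rewrite [X in _ <= rnorm (_ - X)](_ : _ = \sum_(i < n) c i * f (j (x i)))//.
by apply: eq_bigr => i _; rewrite iotaE mulrC.
Qed.

Lemma kolmogorov_width_rdual (K : R) (t0 : T) m :
  (forall t, rnorm (j t) <= K) ->
  (kolmogorov_width m F <= kolmogorov_width m (range j))%E.
Proof.
move=> jK; apply: le_ereal_inf_tmp => _ [_ [k [b [km _ ->]]] <-].
set dev := deviation _ _.
have dist_dev t : (dist (j t) (lin_span b) <= dev)%E.
  by apply: ereal_sup_ubound; exists (j t) => //; exists t.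
(* Two slacks: [d] replaces a best approximation of [j t], and [M] replaces an extension of least
   norm. *)
suff key (d M : R) : (dev < d%:E)%E -> 1 < M ->
    (kolmogorov_width m F <= (M * d)%:E)%E.
  (* The point [t0] excludes the value -oo of a supremum over the empty set. *)
  have dev0 : (0 <= dev)%E.
    apply: le_trans (dist_dev t0); apply: le_ereal_inf_tmp => _ [v _ <-].
    by rewrite lee_fin rnorm_ge0.
  move: key dev0; case: dev dist_dev => [r||] _ key; rewrite ?leey//.
  rewrite lee_fin => r0; apply/lee_addgt0Pr => e e0.
  have d0 : 0 < r + e / 2 by rewrite ltr_wpDl// divr_gt0.
  (* Here [d = r + e / 2] and [M = (r + e) / d], so that [M * d = r + e]. *)
  rewrite -EFinD -(divfK (lt0r_neq0 d0) (r + e)).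
  apply: key; first by rewrite lte_fin ltrDl divr_gt0.
  by rewrite ltr_pdivlMr// mul1r ltrD2l ltr_pdivrMr// mulr_natr mulr2n ltrDl.
move=> devd M1.
have M0 : 0 < M by exact: lt_trans M1.
(* The approximant is picked pointwise; it need not depend linearly or continuously on [t]. *)
have /choice[c cd] t : exists c : 'I_k -> R[i],
    rnorm (j t - \sum_i c i *: b i) < d.
  have /ereal_inf_lt[_ [_ [c _ <-] <-]] := le_lt_trans (dist_dev t) devd.
  by rewrite lte_fin => ?; exists c.
pose v t := \sum_i c t i *: b i.
have vK t : rnorm (v t) <= K + d.
  rewrite -[v t](subKr (j t)) (le_trans (rnormD _ _))//.
  by rewrite lerD// [leLHS]/rnorm normrN ltW// cd.
(* Functionals, not their restrictions, index the family: [f \o v] depends on the chosen extension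
   [f], and only through the [k] numbers [f (b i)]. *)
pose S := {f : X -> R[i] | bounded_functional M f}.
have fvb (s : S) : is_bounded (sval s \o v).
  apply/is_boundedP; exists (M * (K + d)) => t /=.
  by have [_ fM] := svalP s; rewrite (le_trans (fM _))// ler_wpM2l// ltW.
have [n0 t1 c0|V Vm SV] := @finite_rank_basis R (bfun R T) S k
    (fun s => \row_i sval s (b i)) (fun s => BFun (fvb s)).
  move=> xc; apply/val_inj/funext => t.
  rewrite [LHS]bfun_sumE [RHS](_ : _ = 0)//.
  transitivity (\sum_l \sum_i c0 l * (c t i * sval (t1 l) (b i))).
    apply: eq_bigr => l _.
    by rewrite -mulr_sumr -(bounded_functional_sum _ _ _ (svalP (t1 l))).
  rewrite exchange_big big1// => i _.
  transitivity (c t i * (\sum_l c0 l *: (\row_i sval (t1 l) (b i))) 0 i).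
    rewrite summxE mulr_sumr; apply: eq_bigr => l _.
    by rewrite !mxE mulrCA.
  by rewrite xc mxE mulr0.
apply: ge_ereal_inf; exists (deviation F V).
  exists V => //; have [n [y [nk yi ->]]] := Vm.
  by exists n, y; split=> //; exact: leq_trans km.
apply: ge_ereal_sup => _ [_ [g g1 <-] <-].
have [f [fM gf]] := rdual_norm_lt (le_lt_trans g1 M1).
pose s : S := exist _ f fM.
apply: ge_ereal_inf; exists (rnorm (iota g - BFun (fvb s)))%:E.
  by exists (BFun (fvb s)).
rewrite lee_fin; apply: supnorm_le => [|t].
  by rewrite mulr_ge0 ?ltW// (le_lt_trans _ (cd t0)) ?rnorm_ge0.
rewrite [X in rnorm X](_ : _ = iota g t - f (v t))// iotaE gf/=.
rewrite -(bounded_functionalB _ _ fM) (le_trans (fM.2 _))//.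
by rewrite ler_wpM2l ?ltW// cd.
Qed.

End duality.

(** * Boundedness of compact sets, sign of the constant, and conclusion *)

Lemma compact_rnorm_bounded (R : realType) (X : normedModType R[i])
  (A : set X) : compact A -> exists K : R, forall x, A x -> rnorm x <= K.
Proof.
move=> /compact_near_coveringP/(_ nat \oo (fun n x => rnorm x <= n%:R)).
case=> [x Ax|N _ NA]; last by exists N%:R => x; exact: NA (leqnn N) _.
(* On the unit ball around [x] the norm is at most [rnorm x + 1], so a single tail of [n] works near
   [x]. *)
exists ([set y | rnorm (x - y) < 1], [set n | rnorm x + 1 <= n%:R]).
  split=> /=.
    apply/nbhs_normP; exists 1 => //= y xy; rewrite /= -ltcR rnormE.
    exact: xy.
  exact: nbhs_infty_ger.
move=> [y n] [/= xy xn]; apply: le_trans xn.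
rewrite -[y](subKr x) (le_trans (rnormD _ _))// lerD// /rnorm normrN.
exact: ltW.
Qed.

(* The unit ball of B({0, 1}) has d_1 >= 1/2: a space of dimension at most 1
   cannot approximate both indicator functions. *)
Lemma sampling_constant_ge0 (R : realType) (C : R) :
  sampling_constant C -> 0 <= C.
Proof.
move=> hC; rewrite leNgt; apply/negP => C0.
pose E := bfun R bool.
have := hC bool E idfun (ex_intro _ true I) (fun _ _ => id) (fun=> cvg_id)
  1%N isT.
cbv zeta; set F := [set _ | _ in _]; apply/negP; rewrite -ltNge.
have F0 : F 0 by exists 0 => //=; rewrite rnorm0.
(* For negative [C] the right-hand side is negative once the width is positive, whereas sampling
   errors are nonnegative and [F] is nonempty. *)
apply: (@lt_le_trans _ _ 0%E); last first.
  apply: le_ereal_inf_tmp => _ [p _ <-]; apply: le_ereal_sup_tmp.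
  by exists (rnorm (0 - p.2 (\row_i (0 : E) (p.1 i))))%:E;
    [exists 0|rewrite lee_fin rnorm_ge0].
rewrite muleC mule_gt0_lt0 ?lte_fin//; last first.
  by rewrite sqrtr1 mulr1.
apply: (@lt_le_trans _ _ (2^-1)%:E); first by rewrite lte_fin invr_gt0.
apply: le_ereal_inf_tmp => _ [_ [k [b [k1 _ ->]]] <-].
rewrite leNgt; apply/negP => devF.
have delta_bounded (s : bool) : is_bounded (fun t => (t == s)%:R : R[i]).
  apply/is_boundedP; exists 1 => t.
  by case: (t == s); rewrite ?rnorm0// /rnorm normr1.
pose delta s : E := BFun (delta_bounded s).
have approx s : exists c : 'I_k -> R[i],
    forall t, rnorm ((t == s)%:R - \sum_i c i * b i t) < 2^-1.
  have : (dist (delta s) (lin_span b) < 2^-1%:E)%E.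
    apply: le_lt_trans devF; apply: ereal_sup_ubound; exists (delta s) => //.
    exists (delta s) => //=; apply: supnorm_le => // t /=.
    by case: (t == s); rewrite ?rnorm0// /rnorm normr1.
  move=> /ereal_inf_lt[_ [_ [c _ <-] <-]]; rewrite lte_fin => sc.
  exists c => t; apply: le_lt_trans sc.
  apply: le_trans (rnorm_le_supnorm _ t).
  by rewrite [X in _ <= rnorm X](_ : _ = delta s t - (\sum_i c i *: b i) t)//
    bfun_sumE.
have [c cE] := approx true; have [d dE] := approx false.
(* The two approximants are multiples of one function, so their 2 by 2 matrix of values has
   determinant 0. Yet its diagonal entries exceed 1/2 in modulus and the others stay below 1/2. *)
have cross : (\sum_i c i * b i true) * (\sum_i d i * b i false) =
             (\sum_i c i * b i false) * (\sum_i d i * b i true).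
  case: k k1 b devF approx c d cE dE => [|[|//]] _ b _ _ c d _ _.
    by rewrite !big_ord0 !mul0r.
  by rewrite !big_ord1; ring.
have far (z : R[i]) : rnorm (1 - z) < 2^-1 -> 2^-1 < rnorm z.
  move=> z1; have := rnormD (1 - z) z.
  by rewrite subrK [X in X <= _]/rnorm normr1/=; lra.
have near (z : R[i]) : rnorm (0 - z) < 2^-1 -> rnorm z < 2^-1.
  by rewrite sub0r /rnorm normrN.
have : rnorm (\sum_i c i * b i false) * rnorm (\sum_i d i * b i true) <
    2^-1 * 2^-1.
  by rewrite ltr_pM ?rnorm_ge0// near// ?(cE false) ?(dE true).
rewrite -rnormM -cross rnormM; apply/negP; rewrite -leNgt.
by apply: ler_pM; rewrite ?invr_ge0// ltW// far// ?(cE true) ?(dE false).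
Qed.

Theorem theorem2p6 (R : realType) (C : R) (hC : sampling_constant C)
    (X : normedModType R[i]) (A : set X) (hA : compact A) (hA0 : A !=set0)
    (m : nat) (hm : (0 < m)%N) :
  (tau (2 * m) A <= (C * Num.sqrt m%:R)%:E * kolmogorov_width m A)%E.
Proof.
have [K AK] := compact_rnorm_bounded hA; have [a0 Aa0] := hA0.
(* The sampling domain is [A] itself as a type, and [j] is its inclusion in [X]. *)
pose j (t : {a | A a}) := sval t.
have jK t : rnorm (j t) <= K by exact/AK/svalP.
have AE : A = range j.
  apply/seteqP; split=> [a Aa|_ [t _ <-]]; last exact: svalP.
  by exists (exist _ a Aa).
have [iota [iotaE iota_inj iota_cont]] := rdual_embedding jK.
pose t0 : {a | A a} := exist _ a0 Aa0.
rewrite AE; apply: le_trans (tau_le_sampling_width iotaE (2 * m)) _.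
apply: le_trans (hC _ _ iota (ex_intro _ t0 I) iota_inj iota_cont m hm) _.
(* Passing from the width of the dual class to that of [A] under the factor requires the factor to
   be nonnegative. *)
apply: lee_wpmul2l; last exact: (kolmogorov_width_rdual iotaE t0 m jK).
by rewrite lee_fin mulr_ge0 ?sqrtr_ge0// sampling_constant_ge0.
Qed.
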